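(* (a) Let $\mathbf{C}$ be a binary constant weight equidistant code of length $n$, weight $w$ and distance $d$, and let $\mathcal{E}(\mathbf{C})$ be the code of length $n+1$ obtained by appending a coordinate equal to $1$ to every codeword. If $\mathbf{C}$ is trivial, then $\mathcal{E}(\mathbf{C})$ is trivial. (b) Let $\mathbb{C}\subseteq\mathcal{G}_q(n,k)$ be an equidistant constant dimension code, identify $\mathbb{F}_q^{n+1}=\{(x,\alpha):x\in\mathbb{F}_q^n,\alpha\in\mathbb{F}_q\}$, for $X\in\mathcal{G}_q(n,k)$ let $(X,0)=\{(x,0):x\in X\}$, let $v\in\mathbb{F}_q^{n+1}\setminus\{(x,0):x\in\mathbb{F}_q^n\}$, and let $\mathcal{E}(\mathbb{C})=\{\langle (X,0)\cup\{v\}\rangle : X\in\mathbb{C}\}\subseteq\mathcal{G}_q(n+1,k+1)$. If $\mathbb{C}$ is trivial, then $\mathcal{E}(\mathbb{C})$ is trivial.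
   Context: A binary code with $m$ codewords of length $n$ is viewed as an $m\times n$ binary matrix whose rows are the codewords; it is called trivial if every column contains at least $m-1$ equal entries. An equidistant constant dimension code $\mathbb{C}\subseteq\mathcal{G}_q(n,k)$ (set of $k$-subspaces of $\mathbb{F}_q^n$ with all pairwise subspace distances $\dim X+\dim Y-2\dim(X\cap Y)$ equal) is called trivial if one of the following holds: (1) each vector $x\in\mathbb{F}_q^n$ is contained either in all codewords of $\mathbb{C}$, in no codeword of $\mathbb{C}$, or in exactly one codeword of $\mathbb{C}$; or (2) the smallest subspace of $\mathbb{F}_q^n$ containing all codewords of $\mathbb{C}$ has dimension $k+1$. $\langle S\rangle$ denotes the linear span of $S$. *)

(* Defs.v *)
From HB Require Import structures.
From mathcomp Require Import all_boot all_order all_algebra finmap.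

Set Implicit Arguments.
Unset Strict Implicit.
Unset Printing Implicit Defensive.

Import GRing.Theory.
Local Open Scope ring_scope.

Section BinaryCodes.

Variable n : nat.
Implicit Types (C : {set 'rV['F_2]_n}) (x y : 'rV['F_2]_n).

Definition hamming_weight x : nat := #|[set i | x 0 i != 0]|.

Definition hamming_dist x y : nat := #|[set i | x 0 i != y 0 i]|.

Definition constant_weight w C : Prop :=
  forall x, x \in C -> hamming_weight x = w.

Definition hamming_equidistant d C : Prop :=
  forall x y, x \in C -> y \in C -> x != y -> hamming_dist x y = d.

(* The rows are the codewords, in the order of [enum C]; nothing below depends
   on that order. *)
Definition code_matrix C : 'M['F_2]_(#|C|, n) :=
  \matrix_(i < #|C|, j < n) (enum_val i) 0 j.

(* The subtraction [#|C| - 1] is truncated, which matters only for the empty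
   code, whose matrix has no row. *)
Definition binary_trivial C : Prop :=
  forall j : 'I_n, exists b : 'F_2,
    (#|C| - 1 <= #|[set i : 'I_#|C| | code_matrix C i j == b]|)%N.

Definition binary_extension C : {set 'rV['F_2]_(n + 1)} :=
  [set row_mx x (const_mx 1) | x in C].

End BinaryCodes.

Section SubspaceCodes.

Variables (F : finFieldType) (n : nat).
Implicit Types (C : {fset {vspace 'rV[F]_n}}) (X Y W : {vspace 'rV[F]_n}).

(* C is a subset of the Grassmannian G_q(n, k), where q = #|F|. *)
Definition constant_dimension (k : nat) C : Prop :=
  forall X, X \in C -> \dim X = k.

(* The truncated subtraction is harmless: X :&: Y is contained in X and Y. *)
Definition subspace_dist X Y : nat :=
  (\dim X + \dim Y - 2 * \dim (X :&: Y))%N.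

Definition subspace_equidistant C : Prop :=
  exists d : nat, forall X Y,
    X \in C -> Y \in C -> X != Y -> subspace_dist X Y = d.

Definition equidistant_cdc (k : nat) C : Prop :=
  constant_dimension k C /\ subspace_equidistant C.

Definition contains_codewords C W : Prop :=
  forall X, X \in C -> (X <= W)%VS.

Definition smallest_ambient C W : Prop :=
  contains_codewords C W /\
  forall W', contains_codewords C W' -> (W <= W')%VS.

Definition cdc_trivial (k : nat) C : Prop :=
  (forall x : 'rV[F]_n,
     [\/ forall X, X \in C -> x \in X,
         forall X, X \in C -> x \notin X
       | exists! X, X \in C /\ x \in X])
  \/ (exists W, smallest_ambient C W /\ \dim W = k.+1).

Definition lin_span (S : {set 'rV[F]_n}) : {vspace 'rV[F]_n} :=
  <<enum S>>%VS.

End SubspaceCodes.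

Section SubspaceExtension.

Variables (F : finFieldType) (n : nat).

(* F^(n+1) is identified with F^n x F by writing (x, alpha) as the row vector
   [row_mx x (const_mx alpha)]. *)
Definition append_coord (x : 'rV[F]_n) (alpha : F) : 'rV[F]_(n + 1) :=
  row_mx x (const_mx alpha).

Definition pad_zero (X : {vspace 'rV[F]_n}) : {set 'rV[F]_(n + 1)} :=
  [set append_coord x 0 | x in X].

Definition cdc_extension (v : 'rV[F]_(n + 1)) (C : {fset {vspace 'rV[F]_n}}) :
    {fset {vspace 'rV[F]_(n + 1)}} :=
  [fset lin_span (v |: pad_zero X) | X in C]%fset.

End SubspaceExtension.

(* Main.v *)
(* The span of (X, 0) and v is the preimage of X under the projection
   phi : F^(n+1) -> F^n along v.  As phi is onto, with a line as kernel,
   taking preimages commutes with intersections, reflects and preserves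
   inclusions and raises dimensions by one; hence distances are kept, and both
   kinds of triviality are transported from C to its extension. *)

Require Import Defs.
From HB Require Import structures.
From mathcomp Require Import all_boot all_order all_algebra finmap.

Set Implicit Arguments.
Unset Strict Implicit.
Unset Printing Implicit Defensive.

Import GRing.Theory.
Local Open Scope ring_scope.

(** Since [enum_val] is injective, a column can be counted on the set [C] itself, where injective
    images are easy to compare. *)
Lemma card_code_matrix_col n (C : {set 'rV['F_2]_n}) (j : 'I_n) (b : 'F_2) :
  #|[set i | code_matrix C i j == b]| = #|[set x in C | x 0 j == b]|.
Proof.
rewrite -(card_imset _ enum_val_inj); apply: eq_card => x; rewrite inE.
apply/imsetP/andP => [[i + ->]|[xC xj]].
  by rewrite inE mxE => ij; split; first exact: enum_valP.
by exists (enum_rank_in xC x); rewrite ?inE ?mxE enum_rankK_in.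
Qed.

Lemma binary_trivialP n (C : {set 'rV['F_2]_n}) :
  binary_trivial C <->
  forall j, exists b : 'F_2, (#|C| - 1 <= #|[set x in C | x 0%R j == b]|)%N.
Proof.
by split=> tC j; have [b] := tC j; exists b;
  rewrite ?card_code_matrix_col // -card_code_matrix_col.
Qed.

Lemma binary_trivial_extension n (C : {set 'rV['F_2]_n}) :
  binary_trivial C -> binary_trivial (binary_extension C).
Proof.
pose e (x : 'rV['F_2]_n) : 'rV['F_2]_(n + 1) := row_mx x (const_mx 1).
have e_inj : injective e by move=> x y /eq_row_mx[].
move=> /binary_trivialP tC; apply/binary_trivialP => j.
rewrite /binary_extension (card_imset _ e_inj) -(splitK j).
(* An old coordinate keeps its majority value [b]; the appended one is constantly 1. *)
case: (split j) => [i|i] /=.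
  have [b leCb] := tC i; exists b; apply: (leq_trans leCb).
  rewrite -(card_imset _ e_inj); apply/subset_leq_card/subsetP => y /imsetP[x].
  by rewrite !inE => /andP[xC xi] ->; rewrite imset_f //= row_mxEl.
exists 1; apply: (leq_trans (leq_subr _ _)).
rewrite -(card_imset _ e_inj); apply/subset_leq_card/subsetP => _ /imsetP[x xC ->].
by rewrite inE imset_f //= row_mxEr mxE.
Qed.

Section SurjectivePreimage.

Variables (K : fieldType) (aT rT : vectType K) (f : 'Hom(aT, rT)).
Hypothesis f_onto : limg f = fullv.

Lemma lker_sub_lpreim X : (lker f <= f @^-1: X)%VS.
Proof.
by apply/subvP => u; rewrite memv_ker -memv_preim => /eqP->; apply: mem0v.
Qed.

Lemma lpreim_capv X Y : (f @^-1: (X :&: Y) = f @^-1: X :&: f @^-1: Y)%VS.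
Proof. by apply/vspaceP => u; rewrite memv_cap -!memv_preim memv_cap. Qed.

(** Rank-nullity for [f] restricted to the preimage, which contains the whole kernel and is mapped
    onto [X]. *)
Lemma dim_lpreim_onto X : \dim (f @^-1: X) = (\dim (lker f) + \dim X)%N.
Proof.
rewrite -(limg_ker_dim f (f @^-1: X)) lpreimK ?f_onto ?subvf //.
by rewrite (capv_idPr (lker_sub_lpreim X)).
Qed.

(** If [f u = f z] with [z] in [W'], then [u - z] lies in the kernel, hence in [W']. This lifts
    minimality of an ambient space from F^n to F^(n+1). *)
Lemma lpreim_sub_limg W W' :
  (lker f <= W')%VS -> (W <= f @: W')%VS -> (f @^-1: W <= W')%VS.
Proof.
move=> /subvP kW' /subvP sWW'; apply/subvP => u; rewrite -memv_preim => /sWW'.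
case/memv_imgP => z zW' fu; rewrite -(subrK z u); apply: memvD zW'.
by apply: kW'; rewrite memv_ker linearB /= fu subrr.
Qed.

End SurjectivePreimage.

Section Extension.

Variables (F : finFieldType) (n : nat) (v : 'rV[F]_(n + 1)).
Hypothesis v_notin : forall x : 'rV[F]_n, v <> append_coord x 0.

Let last (y : 'rV[F]_(n + 1)) : F := y 0 (rshift n 0).

(** The multiple of [v] is chosen to cancel the last coordinate of [y], which is then dropped; this
    relies on [last v] being nonzero, see [last_v]. *)
Let projv_fun (y : 'rV[F]_(n + 1)) : 'rV[F]_n :=
  lsubmx (y - (last y / last v) *: v).

Let projv_fun_linear : linear projv_fun.
Proof.
move=> a y z; apply/rowP => i; rewrite /projv_fun /last !mxE.
by rewrite mulrDl -mulrA mulrDl mulrBr -!mulrA opprD addrACA.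
Qed.

HB.instance Definition _ :=
  GRing.isLinear.Build F 'rV[F]_(n + 1) 'rV[F]_n _ projv_fun projv_fun_linear.

Definition proj_along : 'Hom('rV[F]_(n + 1), 'rV[F]_n) := linfun projv_fun.

Let last_v : last v != 0.
Proof.
apply/eqP => v0; apply: (v_notin (x := lsubmx v)).
rewrite -[LHS]hsubmxK; congr row_mx; apply/rowP => i.
by rewrite !mxE (ord1 i) -[RHS]v0.
Qed.

Lemma proj_along_v : proj_along v = 0.
Proof.
by rewrite lfunE /= /projv_fun divff // scale1r subrr; apply/rowP => i; rewrite !mxE.
Qed.

Lemma proj_along_append x : proj_along (append_coord x 0) = x.
Proof.
rewrite lfunE /= /projv_fun /last /append_coord row_mxEr mxE mul0r scale0r subr0.
by rewrite row_mxKl.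
Qed.

(** This is the splitting of F^(n+1) as the direct sum of (F^n, 0) and the line of [v]; only the
    last coordinate needs an argument. *)
Lemma proj_along_decomp y :
  y = append_coord (proj_along y) 0 + (last y / last v) *: v.
Proof.
rewrite lfunE /= /projv_fun /append_coord; apply/eqP; rewrite -subr_eq; apply/eqP.
rewrite -[LHS]hsubmxK; congr row_mx; apply/rowP => i; rewrite !mxE (ord1 i).
by rewrite -/(last y) -/(last v) divfK // subrr.
Qed.

Lemma proj_along_onto : limg proj_along = fullv.
Proof.
apply/eqP; rewrite eqEsubv subvf; apply/subvP => x _.
by rewrite -(proj_along_append x) memv_img // memvf.
Qed.

Lemma dim_ker_proj_along : \dim (lker proj_along) = 1.
Proof.
have := limg_ker_dim proj_along fullv.
by rewrite capfv proj_along_onto !dimvf /dim /= !mul1n addnC => /addnI.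
Qed.

(** All generators project into [X]; conversely, the decomposition along [v] writes each vector of
    the preimage in terms of the generators. *)
Lemma lin_span_pad_zero X :
  lin_span (v |: pad_zero X) = (proj_along @^-1: X)%VS.
Proof.
apply/eqP; rewrite eqEsubv; apply/andP; split.
  apply/span_subvP => y; rewrite mem_enum !inE -memv_preim.
  case/orP=> [/eqP->|/imsetP[x xX ->]]; first by rewrite proj_along_v mem0v.
  by rewrite proj_along_append.
apply/subvP => y; rewrite -memv_preim => yX; rewrite [y]proj_along_decomp.
apply: memvD; last apply: memvZ; apply: memv_span; rewrite mem_enum !inE ?eqxx //.
by apply/orP; right; apply: imset_f.
Qed.

Lemma dim_proj_along_preim X : \dim (proj_along @^-1: X) = (\dim X).+1.
Proof. by rewrite dim_lpreim_onto ?proj_along_onto // dim_ker_proj_along. Qed.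

Lemma subspace_dist_preim X Y :
  subspace_dist (proj_along @^-1: X) (proj_along @^-1: Y) = subspace_dist X Y.
Proof.
rewrite /subspace_dist -lpreim_capv !dim_proj_along_preim.
(* Both sides of the truncated subtraction grow by two. *)
by rewrite addSn addnS mulnS add2n !subSS.
Qed.

Variable C : {fset {vspace 'rV[F]_n}}.

Lemma cdc_extensionP Z :
  reflect (exists2 X, X \in C & Z = (proj_along @^-1: X)%VS)
          (Z \in cdc_extension v C).
Proof.
apply: (iffP (imfsetP _ _ _ _)) => -[X XC ->].
  by exists X; rewrite ?lin_span_pad_zero.
by exists X; rewrite ?lin_span_pad_zero.
Qed.

Lemma mem_cdc_extension X :
  X \in C -> (proj_along @^-1: X)%VS \in cdc_extension v C.
Proof. by move=> XC; apply/cdc_extensionP; exists X. Qed.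

Lemma equidistant_cdc_extension k :
  equidistant_cdc k C -> equidistant_cdc (k + 1) (cdc_extension v C).
Proof.
case=> dimC [d distC]; split.
  by move=> _ /cdc_extensionP[X XC ->]; rewrite dim_proj_along_preim dimC ?addn1.
exists d => _ _ /cdc_extensionP[X XC ->] /cdc_extensionP[Y YC ->] neqXY.
(* Distinct preimages come from distinct codewords. *)
by rewrite subspace_dist_preim distC //; apply: contraNneq neqXY => ->.
Qed.

(** A codeword is needed to force the kernel into every ambient space of the extension: for empty
    [C], the preimage of 0 is the line of [v], whereas the smallest ambient space is 0. *)
Lemma smallest_ambient_extension W :
  C != fset0 -> smallest_ambient C W ->
  smallest_ambient (cdc_extension v C) (proj_along @^-1: W)%VS.
Proof.
case/fset0Pn=> X0 X0C [CW minW]; split.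
  by move=> _ /cdc_extensionP[X XC ->]; apply/lpreimS/CW.
move=> W' CW'; apply: lpreim_sub_limg.
  exact: subv_trans (lker_sub_lpreim _ X0) (CW' _ (mem_cdc_extension X0C)).
(* By surjectivity [X] is the image of its own preimage, a codeword contained in [W']. *)
apply: minW => X XC; rewrite -(@lpreimK _ _ _ proj_along X).
  exact/limgS/CW'/mem_cdc_extension.
by rewrite proj_along_onto subvf.
Qed.

Lemma cdc_trivial_extension k :
  cdc_trivial k C -> cdc_trivial (k + 1) (cdc_extension v C).
Proof.
case=> [trivC|[W [ambW dimW]]]; [left=> y|right].
  (* Whether [y] lies in a preimage depends only on its projection, so the case that holds for
     [proj_along y] in [C] holds for [y]. *)
  case: (trivC (proj_along y)) => [allC|noneC|[X [[XC yX] uniqX]]].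
  - by apply: Or31 => _ /cdc_extensionP[X XC ->]; rewrite -memv_preim allC.
  - by apply: Or32 => _ /cdc_extensionP[X XC ->]; rewrite -memv_preim noneC.
  - apply: Or33; exists (proj_along @^-1: X)%VS; split.
      by rewrite mem_cdc_extension // -memv_preim.
    move=> _ [/cdc_extensionP[Y YC ->]]; rewrite -memv_preim => yY.
    by rewrite (uniqX Y).
exists (proj_along @^-1: W)%VS.
split; last by rewrite dim_proj_along_preim dimW addn1.
apply: smallest_ambient_extension => //.
(* The smallest ambient space of the empty code is 0, of dimension < k + 1. *)
apply/eqP => C0; have /dimvS : (W <= 0)%VS by apply: ambW.2 => X; rewrite C0.
by rewrite dimW dimv0.
Qed.

End Extension.

Theorem theorem9 :
  (forall (n w d : nat) (C : {set 'rV['F_2]_n}),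
     constant_weight w C ->
     hamming_equidistant d C ->
     binary_trivial C ->
     binary_trivial (binary_extension C))
  /\
  (forall (F : finFieldType) (n k : nat) (C : {fset {vspace 'rV[F]_n}})
          (v : 'rV[F]_(n + 1)),
     equidistant_cdc k C ->
     (forall x : 'rV[F]_n, v <> append_coord x 0) ->
     cdc_trivial k C ->
     equidistant_cdc (k + 1) (cdc_extension v C) /\
     cdc_trivial (k + 1) (cdc_extension v C)).
Proof.
split=> [n w d C _ _|F n k C v eqC v_notin trivC].
  exact: binary_trivial_extension.
by split; [apply: equidistant_cdc_extension|apply: cdc_trivial_extension].
Qed.
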